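(* Let $A$, $B$ and $C$ be countable groups with $A\le B\le C$. Suppose that $A$ is a measure strong free factor of $C$. Then $A$ is a measure strong free factor of $B$.
   Context: Let $\mathcal{R}$ be a countable Borel equivalence relation on $X$ with Borel subequivalence relations $\mathcal{R}_1,\mathcal{R}_2$. Write $\mathcal{R}=\mathcal{R}_1*\mathcal{R}_2$ (free product decomposition) if $\mathcal{R}$ is generated by $\mathcal{R}_1\cup\mathcal{R}_2$ and, for every $n\geq1$ and every cyclic sequence $(x_i)_{i\in\mathbf{Z}/2n\mathbf{Z}}$ in $X$ with $(x_{2i},x_{2i+1})\in\mathcal{R}_1$ and $(x_{2i+1},x_{2i+2})\in\mathcal{R}_2$ for all $i$, there is $j$ with $x_j=x_{j+1}$. For a Borel action $a$ of a countable group $\Gamma$ on $X$, $\mathcal{R}_a$ is its orbit equivalence relation and, for $\Lambda\le\Gamma$, $\mathcal{R}_{a(\Lambda)}$ is the orbit equivalence relation of the restriction of $a$ to $\Lambda$. A subgroup $\Lambda\le\Gamma$ is a measure strong free factor of $\Gamma$ if for every free Borel action $\Gamma\curvearrowright^a X$ on a standard Borel space and every Borel probability measure $\mu$ on $X$ (not necessarily invariant), there are a $\Gamma$-invariant Borel set $X_0\subseteq X$ of full $\mu$-measure and a Borel subequivalence relation $\mathcal{S}\subseteq(\mathcal{R}_a)_{\restriction X_0}$ such that $(\mathcal{R}_a)_{\restriction X_0}=(\mathcal{R}_{a(\Lambda)})_{\restriction X_0}*\mathcal{S}$. *)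

(* Defs.v *)
From HB Require Import structures.
From mathcomp Require Import all_boot all_order all_algebra.
From mathcomp Require Import all_classical all_reals all_analysis.

Set Implicit Arguments.
Unset Strict Implicit.
Unset Printing Implicit Defensive.

Local Open Scope classical_set_scope.

Section Subgroups.
Context {G : groupType}.

Definition subgroup (H : groupClosed G) : Type := {x : G | x \in H}.

Lemma groupClosed_group_closed (H : groupClosed G) : group_closed H.
Proof. by split; [exact: gpred1 | exact: gpredF]. Qed.

HB.instance Definition _ (H : groupClosed G) := SubChoice.on (subgroup H).
HB.instance Definition _ (H : groupClosed G) :=
  SubChoice_isSubGroup.Build G (mem H) (subgroup H) (groupClosed_group_closed H).

Section SubgroupIn.
Variables H K : groupClosed G.

Definition mem_subgroup_in : {pred subgroup H} := [pred x | val x \in K].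

Lemma mem_subgroup_in1 : 1%g \in mem_subgroup_in.
Proof. by rewrite inE val1 gpred1. Qed.

Lemma mem_subgroup_inM : mulg_closed mem_subgroup_in.
Proof. by move=> x y; rewrite !inE valM; exact: gpredM. Qed.

Lemma mem_subgroup_inV : invg_closed mem_subgroup_in.
Proof.
move=> x; rewrite !inE => xK.
suff -> : val (x^-1)%g = ((val x)^-1)%g by exact: gpredVr.
by apply: (@mulIg _ (val x)); rewrite -valM !mulVg val1.
Qed.

HB.instance Definition _ :=
  isMulClosed.Build (subgroup H) mem_subgroup_in mem_subgroup_inM.
HB.instance Definition _ :=
  isMul1Closed.Build (subgroup H) mem_subgroup_in mem_subgroup_in1.
HB.instance Definition _ :=
  isInvClosed.Build (subgroup H) mem_subgroup_in mem_subgroup_inV.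

(* [K] seen inside the group [H]; this is [K] itself as soon as [K <= H]. *)
Definition subgroup_in : groupClosed (subgroup H) :=
  GroupClosed.clone (subgroup H) mem_subgroup_in _.

End SubgroupIn.
End Subgroups.

(* A completePseudoMetricType carries a complete pseudometric; it is a metric
   exactly when the space is Hausdorff. *)
Definition polish_space (R : realType) (P : completePseudoMetricType R) : Prop :=
  hausdorff_space P /\ exists2 D : set P, countable D & dense D.

(* All measurableTypes of the library are nonempty, so the empty standard Borel
   space is left out; it carries no probability measure. *)
Definition standard_borel (R : realType) d (X : measurableType d) : Prop :=
  exists P : completePseudoMetricType R, polish_space P /\
  exists (f : X -> g_sigma_algebraType (@open P))
         (g : g_sigma_algebraType (@open P) -> X),
    [/\ cancel f g, cancel g f,
        measurable_fun [set: X] f & measurable_fun setT g].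

Section EquivalenceRelations.
Context {T : Type}.

(* A relation on a subset [D] of [T] is a set of pairs contained in [D `*` D]. *)
Definition equivalence_on (D : set T) (E : set (T * T)) : Prop :=
  [/\ E `<=` D `*` D,
      forall x, D x -> E (x, x),
      forall x y, E (x, y) -> E (y, x) &
      forall x y z, E (x, y) -> E (y, z) -> E (x, z)].

Definition restrict_rel (E : set (T * T)) (D : set T) : set (T * T) :=
  E `&` (D `*` D).

(* E = E1 * E2, for E1 and E2 subequivalence relations of E on [D].  The
   indices are computed in 'Z_(2 * n), where [i *+ 2] ranges over the even
   residues. *)
Definition free_product (D : set T) (E E1 E2 : set (T * T)) : Prop :=
  E = smallest (equivalence_on D) (E1 `|` E2) /\
  forall (n : nat) (x : 'Z_(2 * n) -> T), (1 <= n)%N ->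
    (forall i : 'Z_(2 * n), E1 (x (i *+ 2)%R, x (i *+ 2 + 1)%R)) ->
    (forall i : 'Z_(2 * n), E2 (x (i *+ 2 + 1)%R, x (i *+ 2 + 2)%R)) ->
    exists j : 'Z_(2 * n), x j = x (j + 1)%R.

End EquivalenceRelations.

Section Actions.
Context {G : groupType}.

Definition borel_action d (X : measurableType d) (a : G -> X -> X) : Prop :=
  [/\ forall x, a 1%g x = x,
      forall g h x, a (g * h)%g x = a g (a h x) &
      forall g, measurable_fun [set: X] (a g)].

Definition free_action (X : Type) (a : G -> X -> X) : Prop :=
  forall g x, a g x = x -> g = 1%g.

Definition invariant_set (X : Type) (a : G -> X -> X) (D : set X) : Prop :=
  forall g x, D x -> D (a g x).

Definition orbit_rel (X : Type) (a : G -> X -> X) (H : {pred G}) : set (X * X) :=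
  [set p | exists2 g, g \in H & p.2 = a g p.1].

End Actions.

(* Universal over all standard Borel spaces, all free Borel actions and all,
   not necessarily invariant, Borel probability measures. *)
Definition measure_strong_free_factor (R : realType) (G : groupType)
    (L : groupClosed G) : Prop :=
  forall (d : measure_display) (X : measurableType d) (a : G -> X -> X)
         (mu : probability X R),
    standard_borel R X -> borel_action a -> free_action a ->
    exists X0 : set X,
      [/\ measurable X0, invariant_set a X0 & mu X0 = 1%E] /\
      exists S : set (X * X),
        [/\ measurable S, equivalence_on X0 S,
            S `<=` restrict_rel (orbit_rel a predT) X0 &
            free_product X0 (restrict_rel (orbit_rel a predT) X0)
                            (restrict_rel (orbit_rel a L) X0) S].

(* Main.v *)
Require Import Defs.
From HB Require Import structures.
From mathcomp Require Import all_boot all_order all_algebra.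
From mathcomp Require Import all_classical all_reals all_analysis.

Local Open Scope classical_set_scope.

Set Implicit Arguments.
Unset Strict Implicit.
Unset Printing Implicit Defensive.

(** Let [a] be a free action of [B] on [X].  Induce it to [C]: on [C/B x X],
    with cosets represented by elements of [C] and the coset [B] by [1], the
    group [C] acts freely, and on the slice [1] x X its orbit relation is that
    of [B] on [X], while the orbits of [A <= B] stay inside the slice
    ([induced], [induced_base], [induced_base_mem]).  This space is again
    standard Borel ([standard_borel_copies]), so the hypothesis on [A] and [C],
    applied to the image of [mu] on the slice, provides an invariant conull
    Borel set [Y0] and a splitting E = E1 * S on [Y0], where E and E1 are the
    orbit relations of [C] and [A].

    It remains to restrict this splitting to the part [N] of [Y0] in the slice,
    a set which is a union of E1-classes.  Write E1 as the disjoint union of its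
    restrictions to [N] and to the complement of [N].  Since
    E = (E1 on N) * (E1 off N) * S, one has E = (E1 on N) * K, where K is
    generated by S and by E1 off [N] ([contraction]).  The first factor moves
    only points of [N], so nothing is lost by restricting to [N]: a word in
    E1 on [N] and K joining two points of [N] only visits points of [N], and E
    restricted to [N] is (E1 on N) * (K on N) ([free_product_restrict]).
    Freeness is checked on reduced words: between two distinct points of [N], a
    reduced word for K begins and ends with a step of S, because the steps of
    E1 off [N] do not touch [N]; so splicing such words between nontrivial steps
    of E1 on [N] yields a reduced word in E1 and S, which cannot be closed.

    Finally K is Borel: it is the union over [n] of the relations
    S (E1 off N) S ... S, and composing Borel relations contained in the orbit
    relation of a countable group only takes a countable union
    ([measurable_contraction]). *)

(** * Reduced words and the freeness of a pair of relations *)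

Section Zigzags.
Context {T : Type}.
Implicit Types (B E F : set (T * T)) (x y z : T).

(** With [B] the diagonal these are the alternating words in E and F with [n]
    letters each; other choices of [B] give words with an extra first letter. *)
Fixpoint zigzag B E F (n : nat) : set (T * T) :=
  if n is m.+1 then
    [set p | exists u v, [/\ zigzag B E F m (p.1, u), E (u, v) & F (v, p.2)]]
  else B.

Definition off_diagonal E : set (T * T) := E `\` diagonal.

Definition reduced_words E F : nat -> set (T * T) :=
  zigzag diagonal (off_diagonal E) (off_diagonal F).

Lemma zigzag_cat B E F m n x y z :
  zigzag B E F m (x, y) -> zigzag diagonal E F n (y, z) ->
  zigzag B E F (m + n) (x, z).
Proof.
elim: n z => [|n IH] z xy /=.
  by rewrite addn0 /diagonal /= => <-.
case=> u [v [yu uv vz]]; rewrite addnS /=; exists u, v; split=> //.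
exact: IH.
Qed.

Lemma reduced_word_vertices E F n x y : reduced_words E F n (x, y) ->
  exists w : nat -> T, [/\ w 0 = x, w n.*2 = y &
    forall k, (k < n)%N -> off_diagonal E (w k.*2, w k.*2.+1) /\
                           off_diagonal F (w k.*2.+1, w k.*2.+2)].
Proof.
elim: n y => [|n IH] y /=.
  by rewrite /reduced_words /= /diagonal /= => ->; exists (fun=> y).
case=> u [v [/IH[w [w0 wn wE]] uv vy]].
exists (fun k => if (k <= n.*2)%N then w k else if k == n.*2.+1 then v else y).
split=> //=.
  by rewrite leqNgt ltnS leqnSn /= gtn_eqF.
move=> k; rewrite ltnS leq_eqVlt => /orP[/eqP ->|kn].
  by rewrite leqnn ltnn eqxx leqNgt ltnS leqnSn/= gtn_eqF// wn.
rewrite -ltn_double in kn; have kn2 : (k.*2.+1 < n.*2)%N.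
  rewrite ltn_neqAle kn andbT.
  by apply/eqP => /(congr1 odd); rewrite /= !odd_double.
by rewrite (ltnW kn) kn kn2; apply: wE; rewrite -ltn_double.
Qed.

(** A cyclic sequence without repetition unrolls, starting from index 0, into a
    reduced word that closes up, and conversely.  Words, unlike sequences
    indexed by a cyclic group, can be concatenated and built by induction. *)
Lemma cyclic_freeP E F :
  (forall (n : nat) (x : 'Z_(2 * n) -> T), (1 <= n)%N ->
    (forall i : 'Z_(2 * n), E (x (i *+ 2)%R, x (i *+ 2 + 1)%R)) ->
    (forall i : 'Z_(2 * n), F (x (i *+ 2 + 1)%R, x (i *+ 2 + 2)%R)) ->
    exists j : 'Z_(2 * n), x j = x (j + 1)%R) <->
  (forall n x, ~ reduced_words E F n.+1 (x, x)).
Proof.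
split=> [free n x | nocycle [//|n] x _ xE xF]; last first.
  apply: contrapT => /forallNP xx; apply: (nocycle n (x 0%R)).
  have word m : reduced_words E F m (x 0%R, x (m%:R *+ 2)%R).
    elim: m => [|m IH]; first by rewrite GRing.mul0rn.
    exists (x (m%:R *+ 2)%R), (x (m%:R *+ 2 + 1)%R); split=> //.
      by split; [exact: xE | exact: xx].
    rewrite -GRing.natr1 GRing.mulrnDl; split; first exact: xF.
    by rewrite -[(1 *+ 2)%R]/(1 + 1)%R GRing.addrA; exact: xx.
  have := word n.+1; rewrite (_ : (n.+1%:R *+ 2)%R = 0%R)//.
  rewrite -GRing.mulr_natr -GRing.natrM; apply/val_inj.
  by rewrite [LHS]val_Zp_nat ?(mulnC n.+1) ?modnn ?mulnS.
case/reduced_word_vertices => w [w0 wn wE].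
pose X (i : 'Z_(2 * n.+1)) := w i.
have gt1 : (1 < 2 * n.+1)%N by rewrite mulnS.
(* The two ends of the word agree, so [X] also reads off the closing vertex. *)
have XE m : (m <= 2 * n.+1)%N -> X m%:R%R = w m.
  rewrite /X val_Zp_nat// leq_eqVlt => /predU1P[->|/modn_small -> //].
  by rewrite modnn w0 mul2n wn.
have doubleE (i : 'Z_(2 * n.+1)) :
    exists2 k, (k < n.+1)%N & (i *+ 2)%R = (k.*2)%:R%R.
  exists (i %% n.+1)%N; first by rewrite ltn_mod.
  have -> : (i *+ 2)%R = (i * 2)%:R%R by rewrite GRing.mulrnA natr_Zp.
  apply/val_inj; rewrite [LHS]val_Zp_nat// [RHS]val_Zp_nat//.
  by rewrite -mul2n muln_modr modn_mod mulnC.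
have [i|i|j] := free n.+1 X isT.
- have [k kn ->] := doubleE i; rewrite GRing.natr1.
  rewrite !XE ?mul2n ?leq_double// ?ltn_double//; last exact: ltnW.
  by case: (wE k kn) => -[].
- have [k kn ->] := doubleE i; rewrite GRing.natr1 -GRing.natrD addn2.
  rewrite !XE ?mul2n ?ltn_double// -?doubleS ?leq_double//.
  by case: (wE k kn) => _ [].
rewrite -(natr_Zp j) GRing.natr1.
have jn : (j < 2 * n.+1)%N.
  by have := ltn_ord j; rewrite [X in (_ < X)%N -> _]Zp_cast.
rewrite !XE//; last exact: ltnW.
rewrite -(odd_double_half j).
have : (j./2 < n.+1)%N by rewrite ltn_half_double -mul2n.
by move=> /wE[[_ wj1] [_ wj2]]; case: odd.
Qed.
End Zigzags.

(** * Restricting a free product to a set saturated for one factor *)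

Section RestrictFreeProduct.
Context {T : Type} (D N : set T) (E1 E2 : set (T * T)).
Hypotheses (eqE1 : equivalence_on D E1) (eqE2 : equivalence_on D E2).
Hypotheses (N_inv : forall x y, N x -> E1 (x, y) -> N y).

Definition outside : set (T * T) := restrict_rel E1 (~` N).

Definition contraction_chain : nat -> set (T * T) := zigzag E2 outside E2.

(** The relation generated by E2 and by E1 off [N].  Both being transitive and
    E2 reflexive, words that alternate and have E2 at both ends suffice.  In the
    tree whose vertices are the classes of E1 and E2, this amounts to
    contracting to a point each component left after deleting the E1-classes
    inside [N], whence the name. *)
Definition contraction : set (T * T) := \bigcup_n contraction_chain n.

Lemma outside_sym x y : outside (x, y) -> outside (y, x).
Proof. by case: eqE1 => _ _ E1s _ [/E1s ? [/= ? ?]]. Qed.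

Lemma contraction_chain_on n x y : contraction_chain n (x, y) -> D x /\ D y.
Proof.
case: eqE2 => sE2 _ _ _.
elim: n y => [|n IH] y /=; first by move/sE2.
by case=> u [v [/IH[Dx _] _ /sE2[]]].
Qed.

Lemma contraction_trans x y z :
  contraction (x, y) -> contraction (y, z) -> contraction (x, z).
Proof.
case: eqE2 => _ _ _ E2t [m _ xy] [n _ yz].
elim: n z yz => [z|n IH z] /=.
  case: m xy => [|m] /= xy yz; first by exists 0 => //; exact: E2t xy yz.
  case: xy => u [v [xu uv vy]]; exists m.+1 => //.
  by exists u, v; split=> //; exact: E2t vy yz.
case=> u [v [/IH[k _ xu] uv vz]]; exists k.+1 => //.
by exists u, v.
Qed.

Lemma contraction_sym x y : contraction (x, y) -> contraction (y, x).
Proof.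
case: eqE2 => sE2 E2r E2s E2t [n _]; elim: n y => [|n IH] y.
  by move=> xy; exists 0 => //; exact: E2s.
case=> u [v [xu /outside_sym vu /E2s yv]].
apply: contraction_trans (IH _ xu); exists 1 => //; exists v, u; split=> //.
by apply: E2r; case: (contraction_chain_on xu).
Qed.

Lemma contraction_equivalence : equivalence_on D contraction.
Proof.
split=> [[x y] [n _ /contraction_chain_on]//|x Dx|x y|x y z].
- by exists 0 => //; case: eqE2 => _ E2r _ _; exact: E2r.
- exact: contraction_sym.
- exact: contraction_trans.
Qed.

Definition contraction_word : nat -> set (T * T) :=
  zigzag (off_diagonal E2) (off_diagonal outside) (off_diagonal E2).

(** The possible shapes of a reduced word for the contraction that starts at a
    point [x] of [N]: empty, or starting with E2 and ending with either kind of
    step.  It cannot start with a step off [N]. *)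
Definition reduced_from x y : Prop :=
  [\/ y = x, (exists n, contraction_word n (x, y)) |
      exists n u, contraction_word n (x, u) /\ off_diagonal outside (u, y)].

Lemma reduced_from_E2 x y z :
  reduced_from x y -> E2 (y, z) -> reduced_from x z.
Proof.
case: eqE2 => _ _ _ E2t.
have [<- //|yz] := pselect (y = z).
case=> [->|[[|n] xy]|[n [u [xu uy]]]] Eyz; last 1 first.
- by constructor 2; exists n.+1, u, y.
- have [->|xz] := pselect (z = x); first by constructor 1.
  by constructor 2; exists 0; split=> // /esym.
- have [->|xz] := pselect (z = x); first by constructor 1.
  by constructor 2; exists 0; split; [exact: E2t xy.1 Eyz|move=> /esym].
case: xy => u [v [xu uv [/= vy _]]].
(* A new E2-step merges with the last one, which may cancel it. *)
have [vz|vz] := pselect (v = z).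
  by constructor 3; exists n, u; rewrite -vz.
constructor 2; exists n.+1, u, v; split=> //; split=> //.
exact: E2t vy Eyz.
Qed.

Lemma reduced_from_outside x y z :
  N x -> reduced_from x y -> outside (y, z) -> reduced_from x z.
Proof.
move=> Nx; have [<- //|yz] := pselect (y = z).
case=> [->|[n xy]|[n [u [xu [uy _]]]]] yzout.
- by case: yzout => _ [/(_ Nx)].
- by constructor 3; exists n, y.
have [uz|uz] := pselect (u = z).
  by constructor 2; exists n; rewrite -uz.
constructor 3; exists n, u; split=> //; split=> //.
case: eqE1 uy yzout => _ _ _ E1t [uy [/= Nu _]] [yzE [/= _ Nz]].
by split=> //; exact: E1t uy yzE.
Qed.

(** The word ends with E2, as a last step off [N] would not end at a point of
    [N]; hence it can be followed by a step of E1 on [N] and stay reduced. *)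
Lemma contraction_reduced x y :
  N x -> N y -> contraction (x, y) -> x <> y ->
  exists n, contraction_word n (x, y).
Proof.
move=> Nx Ny [n _ xy] neq.
have : reduced_from x y.
  elim: n y xy {Ny neq} => [|n IH] y.
    by apply: reduced_from_E2; constructor 1.
  case=> u [v [xu uv]]; apply: reduced_from_E2.
  apply: reduced_from_outside uv => //.
  exact: IH.
case=> [/esym//|//|[m [u [_ [[_ [_ /(_ Ny)]]]]]]]; exact.
Qed.

Lemma reduced_words_step n u v w :
  off_diagonal E1 (u, v) -> contraction_word n (v, w) ->
  reduced_words E1 E2 n.+1 (u, w).
Proof.
move=> uv; elim: n w => [|n IH] w; first by move=> vw; exists u, v.
case=> a [b [va [[ab _] neq] bw]]; exists a, b; split=> //; exact: IH.
Qed.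

Lemma reduced_words_expand n x y :
  reduced_words (restrict_rel E1 N) (restrict_rel contraction N) n (x, y) ->
  exists m, reduced_words E1 E2 (n + m) (x, y).
Proof.
elim: n y => [|n IH] y; first by move=> xy; exists 0.
case=> u [v [/IH[m xu] [[uv [_ Nv]] uDv] [[vy [_ Ny]] vDy]]].
have [k vyk] := contraction_reduced Nv Ny vy vDy.
exists (m + k); rewrite addSn addnA -addnS.
apply: zigzag_cat xu _.
exact: reduced_words_step (conj uv uDv) vyk.
Qed.

(** An equivalence relation [F] on [N] containing both factors is spread to [D]
    by composing with the contraction on both sides.  The result is an
    equivalence relation containing E1 and E2, and it induces [F] on [N]. *)
Lemma restrict_generated (F : set (T * T)) : equivalence_on N F ->
  restrict_rel E1 N `<=` F -> restrict_rel contraction N `<=` F ->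
  restrict_rel (smallest (equivalence_on D) (E1 `|` E2)) N `<=` F.
Proof.
move=> [sF Fr Fs Ft] E1F KF.
have [sK Kr Ks Kt] := contraction_equivalence.
have [sE1 _ E1s _] := eqE1; have [_ E2r _ _] := eqE2.
pose Q := contraction `|`
  [set p | exists x y,
    [/\ contraction (p.1, x), F (x, y) & contraction (y, p.2)]].
have KNF x y : N x -> N y -> contraction (x, y) -> F (x, y).
  by move=> *; exact: KF.
have FN x y : F (x, y) -> N x /\ N y by move/sF.
have eqQ : equivalence_on D Q.
  split.
  - move=> [u v] [/sK//|[x [y [/sK[Du _] _ /sK[_ Dv]]]]]; split=> //.
  - by move=> x Dx; left; exact: Kr.
  - move=> u v [uv|[x [y [/Ks xu /Fs yx /Ks vy]]]]; first by left; exact: Ks.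
    by right; exists y, x.
  - move=> u v w [uv|[x [y [ux xy yv]]]] [vw|[x' [y' [vx xy' yw]]]].
    + by left; exact: Kt uv vw.
    + by right; exists x', y'; split=> //; exact: Kt uv vx.
    + by right; exists x, y; split=> //; exact: Kt yv vw.
    + right; exists x, y'; split=> //; apply: (Ft _ x' _ _ xy').
      apply: (Ft _ y _ xy _).
      apply: KNF; [by case/FN: xy|by case/FN: xy'|exact: Kt yv vx].
move=> [x y] [/(_ Q) /= xy [/= Nx Ny]].
have [] : Q (x, y).
- apply: xy; split=> // -[u v] [uv|uv]; last by left; exists 0.
  have [/= Du Dv] := sE1 _ uv.
  have [Nu|Nu] := pselect (N u).
    have Nv := N_inv Nu uv.
    by right; exists u, v; split; [exact: Kr|exact: E1F|exact: Kr].
  left; exists 1 => //; exists u, v; split; [exact: E2r| |exact: E2r].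
  by split=> //; split=> //= Nv; apply: Nu; apply: N_inv Nv (E1s _ _ uv).
- exact: KNF.
- move=> [a [b [/= xa ab by_]]]; have [Na Nb] := FN _ _ ab.
  apply: (Ft _ b _ _ (KNF _ _ Nb Ny by_)); apply: (Ft _ a _ _ ab).
  exact: KNF.
Qed.

End RestrictFreeProduct.

Section RestrictFreeProductTheory.
Context {T : Type}.
Implicit Types (D N : set T) (E : set (T * T)).

Lemma smallest_equivalence D E : E `<=` D `*` D ->
  equivalence_on D (smallest (equivalence_on D) E).
Proof.
move=> sE; split.
- apply: smallest_sub => //.
  split=> [//|x Dx|x y [/= Dx Dy]|x y z [/= Dx _] [/= _ Dz]].
  + by split.
  + by split.
  + by split.
- by move=> x Dx F [[_ Fr _ _] _]; exact: Fr.
- by move=> x y xy F FP; case: (FP) => -[_ _ Fs _] _; exact: Fs (xy F FP).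
- move=> x y z xy yz F FP; case: (FP) => -[_ _ _ Ft] _.
  exact: Ft (xy F FP) (yz F FP).
Qed.

Lemma equivalence_restrict D N E : N `<=` D -> equivalence_on D E ->
  equivalence_on N (restrict_rel E N).
Proof.
move=> ND [_ Er Es Et]; split.
- by move=> [x y] [].
- by move=> x Nx; split=> //; apply/Er/ND.
- by move=> x y [/Es xy [/= Nx Ny]].
- by move=> x y z [xy [/= Nx Ny]] [yz [_ /= Nz]]; split=> //; exact: Et xy yz.
Qed.

(** No choice is involved: the complementary factor is the contraction itself,
    which will make its measurability easy. *)
Lemma free_product_restrict D N E E1 E2 :
  equivalence_on D E1 -> equivalence_on D E2 -> N `<=` D ->
  (forall x y, N x -> E1 (x, y) -> N y) ->
  free_product D E E1 E2 ->
  free_product N (restrict_rel E N) (restrict_rel E1 N)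
                 (restrict_rel (contraction N E1 E2) N).
Proof.
move=> eqE1 eqE2 ND N_inv [EE free]; split; last first.
  apply/cyclic_freeP => n x /(reduced_words_expand (D := D))[//|//|m].
  by move/cyclic_freeP: free; apply.
have sE12 : E1 `|` E2 `<=` D `*` D.
  by move=> p []; [case: eqE1|case: eqE2] => sE _ _ _ /sE.
have eqE : equivalence_on D E by rewrite EE; exact: smallest_equivalence.
have sub : E1 `|` E2 `<=` E by rewrite EE; exact: sub_gen_smallest.
apply/seteqP; split.
  move=> p Ep F [eqF sF]; move: p Ep; rewrite EE.
  by apply: restrict_generated => // p ?; apply: sF; [left|right].
apply: smallest_sub; first exact: equivalence_restrict eqE.
move=> p [[pE Np]|[[n _ pK] Np]]; split=> //; first by apply: sub; left.
case: p pK {Np} => x y; elim: n y => [|n IH] y.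
  by move=> xy; apply: sub; right.
case: eqE => _ _ _ Et [u [v [/IH xu [uv _] vy]]].
apply: (Et x v y); last by apply: sub; right.
by apply: Et xu _; apply: sub; left.
Qed.
End RestrictFreeProductTheory.

(** * Transport of a free product along an injection *)

Section Transport.
Context {T U : Type} (j : T -> U).

Definition pullback_rel (E : set (U * U)) : set (T * T) :=
  [set p | E (j p.1, j p.2)].

Lemma pullback_equivalence (N : set U) (E : set (U * U)) :
  equivalence_on N E -> equivalence_on (j @^-1` N) (pullback_rel E).
Proof.
move=> [sE Er Es Et]; split.
- by move=> [x y] /sE.
- by move=> x /Er.
- by move=> x y /Es.
- by move=> x y z /Et; apply.
Qed.

Lemma free_product_pullback (N : set U) (E E1 E2 : set (U * U)) :
  injective j -> N `<=` range j -> E1 `|` E2 `<=` N `*` N ->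
  free_product N E E1 E2 ->
  free_product (j @^-1` N) (pullback_rel E) (pullback_rel E1) (pullback_rel E2).
Proof.
move=> inj_j Nj sN [EE free]; split; last first.
  move=> n x n1 xE1 xE2.
  by have [i /inj_j xi] := free n (j \o x) n1 xE1 xE2; exists i.
have eqE : equivalence_on N E by rewrite EE; exact: smallest_equivalence.
apply/seteqP; split; last first.
  apply: smallest_sub; first exact: pullback_equivalence.
  by move=> p p12; rewrite /pullback_rel /= EE; apply: sub_gen_smallest.
move=> [x y] xy F [[sF Fr Fs Ft] E12F].
pose jF : set (U * U) := [set p | exists x y, [/\ p = (j x, j y) & F (x, y)]].
have [x' [y' [[/inj_j -> /inj_j ->]//]]] : jF (j x, j y).
have jF_E12 : E1 `|` E2 `<=` jF.
  move=> [u v] uv; have [/Nj[a _ au] /Nj[b _ bv]] := sN _ uv.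
  exists a, b; rewrite au bv; split=> //; apply: E12F.
  by case: uv => uv; [left|right]; rewrite /pullback_rel /= au bv.
suff: E `<=` jF by apply.
rewrite EE; apply: smallest_sub => //; split.
- by move=> _ [a [b [-> /sF]]].
- move=> u Nu; have [a _ au] := Nj u Nu.
  by exists a, a; rewrite au; split=> //; apply: Fr; rewrite /= au.
- by move=> _ _ [a [b [[-> ->] /Fs ba]]]; exists b, a.
- move=> _ _ _ [a [b [[-> ->] ab]]] [b' [c [[/inj_j <- ->] bc]]].
  by exists a, c; split=> //; exact: Ft ab bc.
Qed.
End Transport.

(** * Countably many copies of a standard Borel space *)

(** An alias of the product, so as to carry structures that are discrete in the
    first coordinate while [I] itself bears none. *)
Definition copies (I X : Type) : Type := (I * X)%type.

HB.instance Definition _ (I X : choiceType) := Choice.on (copies I X).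
HB.instance Definition _ (I X : pointedType) :=
  isPointed.Build (copies I X) (point, point).

Section CopiesMeasurable.
Context (I : pointedType) d (X : measurableType d).

Definition copies_measurable : set (set (copies I X)) :=
  [set A | forall i, measurable [set x | A (i, x)]].

Lemma copies_measurable0 : copies_measurable set0.
Proof. by move=> i; rewrite (_ : [set _ | _] = set0). Qed.

Lemma copies_measurableC A : copies_measurable A -> copies_measurable (~` A).
Proof. by move=> mA i; exact: (measurableC (mA i)). Qed.

Lemma copies_measurable_bigcup (F : (set (copies I X))^nat) :
  (forall n, copies_measurable (F n)) -> copies_measurable (\bigcup_n F n).
Proof.
move=> mF i; rewrite (_ : [set _ | _] = \bigcup_n [set x | F n (i, x)])//.
by apply: bigcupT_measurable => n; exact: mF.
Qed.

HB.instance Definition _ := isMeasurable.Build d (copies I X)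
  copies_measurable0 copies_measurableC copies_measurable_bigcup.

Lemma measurable_copiesP (A : set (copies I X)) :
  measurable A <-> forall i, measurable [set x | A (i, x)].
Proof. by []. Qed.

Lemma measurable_copy (i : I) :
  measurable_fun [set: X] (fun x => (i, x) : copies I X).
Proof. by move=> _ A mA; rewrite setTI; exact: mA. Qed.

End CopiesMeasurable.

Section CopiesPolish.
Local Open Scope ring_scope.
Context (R : realType) (I : pointedType) (P : completePseudoMetricType R).

(** Different copies are at infinite distance from each other. *)
Definition copies_ball (p : copies I P) (e : R) (q : copies I P) : Prop :=
  p.1 = q.1 /\ ball p.2 e q.2.

Lemma copies_ball_center p (e : R) : 0 < e -> copies_ball p e p.
Proof. by move=> e0; split=> //; exact: ballxx. Qed.

Lemma copies_ball_sym p q (e : R) : copies_ball p e q -> copies_ball q e p.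
Proof. by move=> [pq /ball_sym]. Qed.

Lemma copies_ball_triangle p q r (e1 e2 : R) :
  copies_ball p e1 q -> copies_ball q e2 r -> copies_ball p (e1 + e2) r.
Proof.
by move=> [pq bpq] [qr bqr]; split; [rewrite pq|exact: ball_triangle bqr].
Qed.

HB.instance Definition _ :=
  hasNbhs.Build (copies I P) (nbhs_ (entourage_ copies_ball)).
HB.instance Definition _ := Nbhs_isPseudoMetric.Build R (copies I P)
  erefl copies_ball_center copies_ball_sym copies_ball_triangle erefl.

(** A Cauchy filter contains a ball of radius 1, hence lives in a single copy. *)
Lemma copies_cauchy_cvg (F : set_system (copies I P)) :
  ProperFilter F -> cauchy F -> cvg F.
Proof.
move=> FF Fc; have /cauchyP Fe := Fc.
have [[i x0] Fi] := Fe 1 Num.Theory.ltr01.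
pose G : set_system P := snd @ F.
have /cauchy_cvg/cvg_ex[/= l Gl] : cauchy G.
  apply: cauchy_exP => e e0; have [x Fx] := Fe e e0; exists x.2.
  suff: F (snd @^-1` ball x.2 e) by [].
  by apply: filterS Fx => y [].

have: F --> ((i, l) : copies I P); last exact: cvgP.
apply/fcvg_ballP => e e0.
have Ge : F (snd @^-1` ball l e) by apply: Gl; exact: nbhsx_ballx.
by apply: filterS2 Fi Ge => -[k y] [/= -> _].
Qed.

HB.instance Definition _ :=
  Uniform_isComplete.Build (copies I P) copies_cauchy_cvg.

Local Notation copiesP := (copies I P : completePseudoMetricType R).

Lemma continuous_copy (i : I) : continuous (fun x : P => (i, x) : copiesP).
Proof.
move=> x; apply/cvg_ballP => e e0.
by have := @nbhsx_ballx R P x e e0; apply: filterS => y.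
Qed.

Lemma continuous_copies_snd : continuous (fun p : copiesP => p.2 : P).
Proof.
move=> p; apply/(@cvg_ballP R P copiesP (nbhs p) (nbhs_filter p)) => e e0.
by have := @nbhsx_ballx R copiesP p e e0; apply: filterS => q [].
Qed.

Lemma open_copy (i : I) : open [set p : copiesP | p.1 = i].
Proof.
rewrite openE => p <-; have := @nbhsx_ballx R copiesP p 1 Num.Theory.ltr01.
by apply: filterS => q [].
Qed.

Lemma copies_polish : countable [set: I] -> polish_space P ->
  polish_space copiesP.
Proof.
rewrite /polish_space !ball_hausdorff => cI [hP [D cD denseD]]; split.
  move=> [i x] [k y] neq; have [ik|ik] := pselect (i = k); last first.
    exists (1%:pos, 1%:pos); apply/eqP/seteqP; split=> // z [[iz _] [kz _]].
    by apply: ik; rewrite [LHS]iz [RHS]kz.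
  have /hP[r /eqP rxy] : x != y by apply: contraNneq neq => ->; rewrite ik.
  exists r; apply/eqP/seteqP; split=> // z [[_ xz] [_ yz]].
  by suff: set0 z.2 by []; rewrite -rxy.
exists ([set: I] `*` D); first exact: countableX.
move=> O [[i x] Oix] oO.
have [y [Oy Dy]] : [set y | O (i, y)] `&` D !=set0.
  apply: denseD; first by exists x.
  by have /continuousP := @continuous_copy i; apply.
by exists (i, y).
Qed.
End CopiesPolish.

Lemma measurable_copies_snd (R : realType) (I : pointedType)
    (P : completePseudoMetricType R) :
  measurable_fun setT (snd : g_sigma_algebraType (@open (copies I P)) ->
                             g_sigma_algebraType (@open P)).
Proof.
apply: (@measurability _ _ (g_sigma_algebraType (@open (copies I P)))
  (g_sigma_algebraType (@open P)) setT snd (@open P)) => // _ [W oW <-].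
rewrite setTI.
apply: sub_sigma_algebra.
by have /continuousP := @continuous_copies_snd R I P; exact.
Qed.

Lemma standard_borel_copies (R : realType) (I : pointedType) d
    (X : measurableType d) :
  countable [set: I] -> standard_borel R X -> standard_borel R (copies I X).
Proof.
move=> cI [P [polP [f [g [fK gK mf mg]]]]].
exists (copies I P); split; first exact: copies_polish.
exists (fun p => (p.1, f p.2)), (fun p => (p.1, g p.2)); split.
- by move=> [i x] /=; rewrite fK.
- by move=> [i x] /=; rewrite gK.
- apply: (@measurability _ _ (copies I X)
    (g_sigma_algebraType (@open (copies I P))) setT _
    (@open (copies I P))) => //.
  move=> _ [W oW <-]; rewrite setTI; apply/measurable_copiesP => i.
  have := mf measurableT [set y | W (i, y)]; rewrite setTI; apply.
  apply: sub_sigma_algebra.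
  by have /continuousP := @continuous_copy R I P i; exact.
move=> _ A /measurable_copiesP mA; rewrite setTI.
rewrite (_ : _ @^-1` A =
    \bigcup_i ([set p | p.1 = i] `&` snd @^-1` (g @^-1` [set x | A (i, x)]))).
  apply: countable_bigcupT_measurable => // i; apply: measurableI.
    by apply: sub_sigma_algebra; exact: open_copy.
  rewrite -[X in measurable X]setTI; apply: measurable_copies_snd => //.
  by rewrite -[X in measurable X]setTI; apply: mg.
by apply/seteqP; split=> [[i x] Aix|[i x] [k _ [/= <-]]//]; exists i.
Qed.

(** * Measurability of relations generated inside an orbit relation *)

Lemma orbit_equivalence (G : groupType) (L : groupClosed G) (X : Type)
    (a : G -> X -> X) (D : set X) :
  (forall x, a 1%g x = x) -> (forall g h x, a (g * h)%g x = a g (a h x)) ->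
  equivalence_on D (restrict_rel (orbit_rel a L) D).
Proof.
move=> a1 aM; split.
- by move=> [x y] [].
- by move=> x Dx; split=> //; exists 1%g; [exact: gpred1|rewrite a1].
- move=> x y [[g gL /= ->] [/= Dx Dgx]]; split=> //.
  by exists g^-1%g; [exact: gpredVr|rewrite /= -aM mulVg a1].
- move=> x y z [[g gL /= ->] [/= Dx _]] [[h hL /= ->] [_ /= Dz]]; split=> //.
  by exists (h * g)%g; [exact: gpredM|rewrite aM].
Qed.

Section MeasurableContraction.
Context (G : groupType) d (X : measurableType d) (a : G -> X -> X).
Hypotheses (G_countable : countable [set: G]) (borel_a : borel_action a).
Implicit Types (E F : set (X * X)) (D N : set X).

Let preimage_measurable d1 d2 (T1 : measurableType d1) (T2 : measurableType d2)
  (f : T1 -> T2) (A : set T2) :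
  measurable_fun setT f -> measurable A -> measurable (f @^-1` A).
Proof. by move=> mf mA; rewrite -[X in measurable X]setTI; exact: mf. Qed.

(** The intermediate point of a composition is [a g x] for one of countably many
    [g], so the projection defining the composition is a countable union. *)
Lemma measurable_comp_rel E F :
  E `<=` orbit_rel a predT -> measurable E -> measurable F ->
  measurable [set p | exists y, E (p.1, y) /\ F (y, p.2)].
Proof.
move=> sE mE mF; have [_ _ ma] := borel_a.
rewrite (_ : [set _ | _] = \bigcup_g
    ((fun p => (p.1, a g p.1)) @^-1` E `&` (fun p => (a g p.1, p.2)) @^-1` F)).
  apply: countable_bigcupT_measurable => // g.
  have mg : measurable_fun setT (fun p : X * X => a g p.1).
    by apply: measurableT_comp (ma g) measurable_fst.
  apply: measurableI; apply: preimage_measurable => //.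
    by apply: measurable_fun_pair => //; exact: measurable_fst.
  by apply: measurable_fun_pair => //; exact: measurable_snd.
apply/seteqP; split=> [[x z] [y [/= /[dup] xy /sE[g _ /= yE] yz]]|].
  by exists g => //; split; rewrite /= -yE.
by move=> [x z] [g _ [xg gz]]; exists (a g x).
Qed.

(** The orbit relation appears here only in composition with [F], which spares
    proving that graphs of Borel maps are Borel. *)
Lemma measurable_orbit_step (L : {pred G}) D F :
  measurable D -> measurable F ->
  measurable [set p | exists y,
    restrict_rel (orbit_rel a L) D (p.1, y) /\ F (y, p.2)].
Proof.
move=> mD mF; have [_ _ ma] := borel_a.
rewrite (_ : [set _ | _] = \bigcup_g
    if g \in L then fst @^-1` D `&` (fun p => a g p.1) @^-1` D `&`
                    (fun p => (a g p.1, p.2)) @^-1` F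
    else set0).
  apply: countable_bigcupT_measurable => // g; case: ifP => // _.
  have mg : measurable_fun setT (fun p : X * X => a g p.1).
    by apply: measurableT_comp (ma g) measurable_fst.
  apply: measurableI; [apply: measurableI|]; apply: preimage_measurable => //.
  by apply: measurable_fun_pair => //; exact: measurable_snd.
apply/seteqP; split=> [[x z] [y [[[g gL /= ->] [Dx Dy]] yz]]|].
  by exists g => //; rewrite gL.
move=> [x z] [g _]; case: ifP => // gL [[Dx Dgx] gz].
by exists (a g x); split=> //; split=> //; exists g.
Qed.

Lemma measurable_contraction (L : {pred G}) D N F :
  measurable D -> measurable N -> measurable F -> F `<=` orbit_rel a predT ->
  measurable (contraction N (restrict_rel (orbit_rel a L) D) F).
Proof.
move=> mD mN mF sF; have [_ aM _] := borel_a.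
apply: bigcupT_measurable => n.
elim: n => [//|n IH].
have sub m : contraction_chain N (restrict_rel (orbit_rel a L) D) F m `<=`
             orbit_rel a predT.
  elim: m => [//|m sm] [x y] [u [v [/sm[g _ /= ->]]]].
  move=> [[[h _ /= ->] _] _] /sF[k _ /= ->].
  by exists (k * h * g)%g; rewrite //= !aM.
pose outF : set (X * X) := [set p | exists v,
  restrict_rel (orbit_rel a L) (D `\` N) (p.1, v) /\ F (v, p.2)].
have moutF : measurable outF.
  by apply: measurable_orbit_step mF; exact: measurableD.
rewrite (_ : contraction_chain _ _ _ _ = [set p | exists u,
    contraction_chain N (restrict_rel (orbit_rel a L) D) F n (p.1, u) /\
    outF (u, p.2)]); first exact: measurable_comp_rel.
apply/seteqP; split=> [[x y] [u [v [xu [[uv [Du Dv]] [Nu Nv]] vy]]]|].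
  by exists u; split=> //; exists v.
by move=> [x y] [u [xu [v [[uv [[Du Nu] [Dv Nv]]] vy]]]]; exists u, v.
Qed.
End MeasurableContraction.

(** * The induced action *)

Section CosetRepresentatives.
Context {C : groupType} (B : groupClosed C).
Local Open Scope group_scope.

(** The coset [B] is represented by [1], so that the slice over it carries the
    given action itself rather than a conjugate of it. *)
Definition coset_rep (c : C) : C :=
  if c \in B then 1 else choose (fun k => c^-1 * k \in B) c.

Lemma coset_rep_mem c : c^-1 * coset_rep c \in B.
Proof.
rewrite /coset_rep; case: ifPn => [cB|_]; first by rewrite mulg1 gpredVr.
by apply: (chooseP (P := fun k => c^-1 * k \in B)); rewrite mulVg gpred1.
Qed.

Lemma coset_repV_mem c : (coset_rep c)^-1 * c \in B.
Proof.
rewrite (_ : _ * _ = (c^-1 * coset_rep c)^-1) ?gpredVr ?coset_rep_mem//.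
by rewrite invgM invgK.
Qed.

Lemma coset_rep_eq c b : b \in B -> coset_rep (c * b) = coset_rep c.
Proof.
move=> bB; rewrite /coset_rep; have [cB|cB] := boolP (c \in B).
  by rewrite gpredM.
have /negbTE -> : c * b \notin B.
  by apply: contra cB => cbB; rewrite -(mulgK b c) gpredM ?gpredVr.
have PQ : (fun k => (c * b)^-1 * k \in B) =1 (fun k => c^-1 * k \in B).
  move=> k; rewrite invgM -mulgA; apply/idP/idP => kB; last first.
    by rewrite gpredM ?gpredVr.
  by rewrite -(mulKg b^-1 (c^-1 * k)) invgK gpredM.
rewrite (eq_choose PQ); apply: choose_id; rewrite ?mulKg ?mulVg ?gpred1//.
Qed.

Lemma coset_rep_in b : b \in B -> coset_rep b = 1.
Proof. by rewrite /coset_rep => ->. Qed.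

Lemma coset_rep_in_eq c : coset_rep c = 1 -> c \in B.
Proof. by move=> c1; have := coset_repV_mem c; rewrite c1 invg1 mul1g. Qed.

Lemma coset_rep_mulr g c : coset_rep (g * coset_rep c) = coset_rep (g * c).
Proof.
rewrite -[in LHS](mulVKg c (coset_rep c)) mulgA [LHS]coset_rep_eq//.
exact: coset_rep_mem.
Qed.

Lemma coset_rep_id c : coset_rep (coset_rep c) = coset_rep c.
Proof. by have := coset_rep_mulr 1 c; rewrite !mul1g. Qed.

Definition cosets := {k : C | coset_rep k == k}.
HB.instance Definition _ := Choice.on cosets.

Definition coset (c : C) : cosets :=
  exist _ (coset_rep c) (introT eqP (coset_rep_id c)).

HB.instance Definition _ := isPointed.Build cosets (coset 1).

Lemma val_coset c : val (coset c) = coset_rep c. Proof. by []. Qed.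

Lemma coset_val (k : cosets) : coset (val k) = k.
Proof. by apply: val_inj; rewrite val_coset; exact/eqP/(valP k). Qed.

Lemma val_coset1 : val (point : cosets) = 1.
Proof. by rewrite [LHS]coset_rep_in ?gpred1. Qed.

Lemma countable_cosets : countable [set: C] -> countable [set: cosets].
Proof.
move=> /pcard_injP[f f_inj]; apply/pcard_injP; exists (f \o val) => i k _ _.
by move=> /f_inj ik; apply/val_inj/ik; rewrite inE.
Qed.

(** The element of [B] by which [g] acts on the fibre when it moves the coset of
    [k] to that of [g * k]; it lies in [B] by [coset_repV_mem], so the default
    value [1] is never taken. *)
Definition cocycle (g k : C) : subgroup B :=
  insubd (1 : subgroup B) ((coset_rep (g * k))^-1 * (g * k)).

Lemma val_cocycle g k : val (cocycle g k) = (coset_rep (g * k))^-1 * (g * k).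
Proof. by rewrite /cocycle insubdK//; exact: coset_repV_mem. Qed.

Lemma cocycle1 (k : cosets) : cocycle 1 (val k) = 1.
Proof.
apply: val_inj; rewrite val_cocycle mul1g -val_coset coset_val mulVg.
by rewrite val1.
Qed.

Lemma cocycleM g h k :
  cocycle (g * h) k = cocycle g (coset_rep (h * k)) * cocycle h k.
Proof.
apply: val_inj; rewrite valM !val_cocycle coset_rep_mulr.
by rewrite -!mulgA mulVKg.
Qed.

Section InducedAction.
Context (X : Type) (a : subgroup B -> X -> X).

Definition induced (g : C) (p : copies cosets X) : copies cosets X :=
  (coset (g * val p.1), a (cocycle g (val p.1)) p.2).

Hypotheses (a1 : forall x, a 1 x = x).
Hypotheses (aM : forall g h x, a (g * h) x = a g (a h x)).

Lemma induced1 p : induced 1 p = p.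
Proof. by case: p => k x; rewrite /induced /= mul1g coset_val cocycle1 a1. Qed.

Lemma inducedM g h p : induced (g * h) p = induced g (induced h p).
Proof.
case: p => k x; rewrite /induced /= cocycleM aM; congr pair.
by apply: val_inj; rewrite !val_coset coset_rep_mulr mulgA.
Qed.

Lemma induced_free : free_action a -> free_action induced.
Proof.
move=> free g [k x] [/(congr1 val) gk /free gx].
have := congr1 val gx; rewrite val_cocycle val1 -val_coset gk.
move=> /(canRL (mulVKg _)); rewrite mulg1 => /(canRL (mulgK _)).
by rewrite mulgV.
Qed.

Lemma induced_base g x : g \in B ->
  induced g (point, x) = (point, a (insubd 1 g) x).
Proof.
move=> gB; rewrite /induced val_coset1 mulg1; congr pair.
  by apply: val_inj; rewrite val_coset1 val_coset coset_rep_in.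
congr (a _ _); apply: val_inj.
by rewrite val_cocycle mulg1 coset_rep_in// invg1 mul1g insubdK.
Qed.

(** So two points of the base slice in one [C]-orbit are in one [B]-orbit. *)
Lemma induced_base_mem g x : (induced g (point, x)).1 = point -> g \in B.
Proof.
move/(congr1 val); rewrite val_coset val_coset1 mulg1; exact: coset_rep_in_eq.
Qed.
End InducedAction.

Lemma borel_induced d (X : measurableType d) (a : subgroup B -> X -> X) :
  borel_action a -> borel_action (induced a).
Proof.
case=> a1 aM ma; split=> [p|g h p|g _ A mA].
- exact: induced1.
- exact: inducedM.
rewrite setTI; apply/measurable_copiesP => k.
rewrite (_ : [set _ | _] =
    a (cocycle g (val k)) @^-1` [set x | A (coset (g * val k), x)])//.
by rewrite -[X in measurable X]setTI; apply: ma => //; exact: mA.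
Qed.
End CosetRepresentatives.

(** * The theorem *)

(** The inclusion of a copy, named in order to bear its measurable structure. *)
Definition copy_at (I : pointedType) (X : Type) (i : I) (x : X) : copies I X :=
  (i, x).

HB.instance Definition _ (I : pointedType) d (X : measurableType d) (i : I) :=
  isMeasurableFun.Build d d X (copies I X) (copy_at i) (measurable_copy i).

Theorem lemma5p17 (R : realType) (C : groupType) (A B : groupClosed C)
    (C_countable : countable [set: C]) (sAB : {subset A <= B})
    (A_factor_C : measure_strong_free_factor R A) :
  measure_strong_free_factor R (subgroup_in B A).
Proof.
move=> d X a mu stdX borel_a free_a.
have [a1 aM _] := borel_a.
pose Y := copies (cosets B) X.
pose act := induced a.
pose j : X -> Y := copy_at (point : cosets B).
pose nu : probability Y R := distribution mu j.
have borel_act : borel_action act := borel_induced borel_a.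
have [act1 actM _] := borel_act.
have [Y0 [[mY0 invY0 nuY0] [S [mS eqS sS freeS]]]] := A_factor_C d Y act nu
  (standard_borel_copies (countable_cosets B C_countable) stdX)
  borel_act (induced_free free_a).
pose N : set Y := Y0 `&` [set p | p.1 = point].
pose E1 := restrict_rel (orbit_rel act A) Y0.
pose K := restrict_rel (contraction N E1 S) N.
have inj_j : injective j by move=> x y [].
have jN : j @^-1` N = j @^-1` Y0 by apply/seteqP; split=> x; [case|split].
have mj : measurable_fun setT j by exact: measurable_copy.
have act_j (b : subgroup B) x : act (val b) (j x) = j (a b x).
  by rewrite /act /j /copy_at induced_base ?valKd//; exact: (valP b).
have mX0 : measurable (j @^-1` Y0).
  by rewrite -[X in measurable X]setTI; exact: mj.
have mN : measurable N.
  apply: measurableI => //; apply/measurable_copiesP => k.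
  have [->|kp] := pselect (k = point).
    by rewrite (_ : [set _ | _] = setT)//; apply/seteqP; split.
  by rewrite (_ : [set _ | _] = set0)//; apply/seteqP; split.
have eqE1 : equivalence_on Y0 E1 by exact: orbit_equivalence.
have NY0 : N `<=` Y0 by move=> p [].
have N_inv x y : N x -> E1 (x, y) -> N y.
  case: x => k x [_ /= kp] [[g gA /= ->] [_ Y0y]]; split=> //.
  by rewrite kp /act induced_base ?sAB.
have freeN := free_product_restrict eqE1 eqS NY0 N_inv freeS.
have eqK : equivalence_on N K.
  by apply: equivalence_restrict NY0 _; exact: contraction_equivalence.
have sKN : restrict_rel E1 N `|` K `<=` N `*` N by move=> p [] [].
have Nj : N `<=` range j by move=> [k x] [_ /= ->]; exists x.
have freeX := free_product_pullback inj_j Nj sKN freeN.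
exists (j @^-1` Y0); split.
  split=> //.
  by move=> b x Y0x; rewrite /= -act_j; exact: invY0.
exists (pullback_rel j K).
have orbitE (L : {pred C}) (M : {pred subgroup B}) :
    (forall b, (b \in M) = (val b \in L)) ->
    pullback_rel j (restrict_rel (restrict_rel (orbit_rel act L) Y0) N) =
    restrict_rel (orbit_rel a M) (j @^-1` Y0).
  move=> ML; apply/seteqP; split=> -[x y].
    case=> -[[g gL /= jy] _] [/= [Y0x _] [Y0y _]]; split=> //.
    have gB : g \in B.
      apply: (@induced_base_mem _ B _ a g x).
      by rewrite -[LHS]/(act g (j x)).1 -jy.
    exists (insubd 1%g g); first by rewrite ML insubdK.
    by apply: inj_j; rewrite jy /= -act_j insubdK.
  case=> -[b bM /= ->] [/= Y0x Y0y]; split=> //; split=> //.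
  by exists (val b); rewrite -?ML//= act_j.
have sSact : S `<=` orbit_rel act predT by move=> p /sS[].
rewrite jN in freeX; rewrite /E1 !(orbitE predT predT)// in freeX.
rewrite (orbitE A (subgroup_in B A))// in freeX.
split=> //.
- rewrite (_ : pullback_rel j K = ((j @^-1` Y0) `*` (j @^-1` Y0)) `&`
      (fun p => (j p.1, j p.2)) @^-1` contraction N E1 S); last first.
    by apply/seteqP; split=> -[x y]; [case=> ? [[? _] [? _]]|case=> -[]].
  apply: measurableI; first exact: measurableX.
  rewrite -[X in measurable X]setTI.
  apply: measurable_fun_pair => //.
  + by apply: measurableT_comp mj measurable_fst.
  + by apply: measurableT_comp mj measurable_snd.
  exact: measurable_contraction.
- by rewrite -jN; exact: pullback_equivalence.
- by rewrite freeX.1 => p pK; apply: sub_gen_smallest; right.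
Qed.
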